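(* Let $h:\mathbb{R}\to\mathbb{R}$ be a function, not identically zero, such that $h(x)=h(|x|)\ge0$ for all $x$; $h(x)/x$ is monotone increasing for $x>0$; $h(x)/x^2$ is monotone decreasing for $x>0$; and $h(0)=0$. Let $g:[0,\infty)\to(0,\infty)$ be an increasing function. Put $A_n=\sum_{k=1}^n v_k$. Then in the unbounded forecasting game with general hedge with parameter $h$, Reality can strongly comply with the event \[\sum_n\frac{v_n}{g(A_n)}<\infty\iff\frac{\sum_{k=1}^n(x_k-m_k)}{h^{-1}(g(A_n))}\ \text{ converges (as } n\to\infty).\]
   Context: Unbounded forecasting game with general hedge (parameter: a single function $h:\mathbb{R}\to\mathbb{R}$; players Forecaster, Skeptic, Reality; perfect information): $\mathcal{K}_0:=1$. For $n=1,2,\ldots$: Forecaster announces $m_n\in\mathbb{R}$ and $v_n\ge0$; then Skeptic announces $M_n\in\mathbb{R}$ and $V_n\ge0$; then Reality announces $x_n\in\mathbb{R}$; then $\mathcal{K}_n:=\mathcal{K}_{n-1}+M_n(x_n-m_n)+V_n(h(x_n-m_n)-v_n)$. Collateral duty of Skeptic: he must keep $\mathcal{K}_n$ non-negative for all $n$. A path is the infinite sequence $\xi=(m_1,v_1,x_1,m_2,v_2,x_2,\ldots)$ of moves of Forecaster and Reality; an event is any set of paths. A strategy of Reality is a deterministic rule giving $x_n$ as a function of all moves of all players made before it (including $m_n,v_n,M_n,V_n$). Reality strongly complies with an event $E$ by a strategy $R$ if, whenever Reality follows $R$, irrespective of the moves of Forecaster and Skeptic (with Skeptic observing his collateral duty),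 (i) the resulting path $\xi$ belongs to $E$, and (ii) $\mathcal{K}_n\le\mathcal{K}_0$ for all $n$. Reality can strongly comply with $E$ if such a strategy exists. Monotone increasing/decreasing is understood in the weak sense (so that e.g. $h(x)=|x|^r$ with $1\le r\le2$ is allowed). $h^{-1}$ denotes the inverse of the restriction of $h$ to $[0,\infty)$, which under the hypotheses is an increasing bijection of $[0,\infty)$ onto itself. ''Converges'' means converges to a real number. *)

(* Defs.v *)
From HB Require Import structures.
From mathcomp Require Import all_boot all_order all_algebra.
From mathcomp Require Import all_classical all_reals all_analysis.

Set Implicit Arguments.
Unset Strict Implicit.
Unset Printing Implicit Defensive.

Import Order.TTheory GRing.Theory Num.Theory.
Import numFieldNormedType.Exports.

Local Open Scope classical_set_scope.
Local Open Scope ring_scope.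

Section unbounded_forecasting_game.
Variable R : realType.

(* Forecaster's m_n and v_n, Skeptic's M_n (stake_mean) and V_n (stake_hedge),
   and Reality's x_n *)
Record round := Round {
  mean : R; price : R; stake_mean : R; stake_hedge : R; outcome : R }.

(* [p k] is round k + 1: rounds are numbered from 1 in the mathematics. *)
Definition play := nat -> round.

Definition legal (p : play) :=
  forall n, 0 <= price (p n) /\ 0 <= stake_hedge (p n).

Record game_path := GamePath { path_m : R^nat; path_v : R^nat; path_x : R^nat }.

Definition path_of_play (p : play) : game_path :=
  GamePath (mean \o p) (price \o p) (outcome \o p).

(* [capital h p n] is Skeptic's capital after the first n rounds. *)
Fixpoint capital (h : R -> R) (p : play) (n : nat) : R :=
  if n is k.+1 then
    capital h p k
    + stake_mean (p k) * (outcome (p k) - mean (p k))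
    + stake_hedge (p k) * (h (outcome (p k) - mean (p k)) - price (p k))
  else 1.

Definition collateral_duty (h : R -> R) (p : play) :=
  forall n, 0 <= capital h p n.

(* A strategy receives the completed rounds, in chronological order, and then
   the moves m, v, M, V of the current round. *)
Definition reality_strategy := seq round -> R -> R -> R -> R -> R.

Definition follows (rs : reality_strategy) (p : play) :=
  forall n, outcome (p n) =
    rs (mkseq p n) (mean (p n)) (price (p n))
       (stake_mean (p n)) (stake_hedge (p n)).

Definition strongly_complies_by (h : R -> R) (E : set game_path)
    (rs : reality_strategy) :=
  forall p : play, legal p -> collateral_duty h p -> follows rs p ->
    E (path_of_play p) /\ (forall n, capital h p n <= capital h p 0%N).

Definition can_strongly_comply (h : R -> R) (E : set game_path) :=
  exists rs : reality_strategy, strongly_complies_by h E rs.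

Definition cumul_price (xi : game_path) (n : nat) : R :=
  \sum_(k < n) path_v xi k.

Definition cumul_dev (xi : game_path) (n : nat) : R :=
  \sum_(k < n) (path_x xi k - path_m xi k).

Definition hedge_inv (h : R -> R) : R -> R :=
  'pinv_(fun=> 0) `[0, +oo[ h.

End unbounded_forecasting_game.

(* Main.v *)
(** Let y_n = x_n - m_n and q_n = v_n / max(v_n, g(A_n)). Suppose Reality drew
    y_n from {a_n, -a_n, 0}, with a_n = h^{-1}(max(v_n, g(A_n))) and
    probabilities q_n/2, q_n/2, 1 - q_n. Then E y_n = 0 and E h(y_n) = v_n, so
    Skeptic's capital K would be a martingale, and by Borel-Cantelli the event
    would hold almost surely: if sum q_n < oo there are finitely many jumps, and
    if sum q_n = oo there are infinitely many of each sign, each at least as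
    large as the denominator, which prevents convergence.
    The strategy derandomizes this with the positive supermartingale
    T = 2^N / prod (1 + q_k) + (2^{-N_+} + 2^{-N_-}) prod (1 + q_k / 4),
    where N, N_+, N_- count all, the positive and the negative jumps; the event
    holds whenever T is bounded. To keep K <= 1 exactly rather than up to a
    constant, Reality chooses y_n so that (1 - K_n) / T_n does not decrease,
    which is possible on average, and, while K_n = 1, so that either K drops
    below 1 or T does not increase. *)
Require Import Defs.
From HB Require Import structures.
From mathcomp Require Import all_boot all_order all_algebra.
From mathcomp Require Import all_classical all_reals all_analysis.
From mathcomp Require Import ring lra.

Set Implicit Arguments.
Unset Strict Implicit.
Unset Printing Implicit Defensive.

Import Order.TTheory GRing.Theory Num.Theory.
Import numFieldNormedType.Exports.

Local Open Scope classical_set_scope.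
Local Open Scope ring_scope.

(** * Hedge functions: growth, continuity, inverse *)

Definition hedge_function (R : realType) (h : R -> R) :=
  [/\ h 0 = 0,
      forall x, h x = h `|x|,
      forall x, 0 < x -> 0 < h x,
      forall x y, 0 < x -> x <= y -> h x / x <= h y / y &
      forall x y, 0 < x -> x <= y -> h y / y ^+ 2 <= h x / x ^+ 2].

(** Positivity at one point [y] spreads to the left because h(x)/x^2 decreases and to the right
    because h(x)/x increases. *)
Lemma hedge_gt0 (R : realType) (h : R -> R)
  (h_neq0 : exists x, h x != 0)
  (h_abs : forall x, h x = h `|x|)
  (h_ge0 : forall x, 0 <= h x)
  (h_div_incr : forall x y, 0 < x -> x <= y -> h x / x <= h y / y)
  (h_div2_decr : forall x y, 0 < x -> x <= y -> h y / y ^+ 2 <= h x / x ^+ 2)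
  (h0 : h 0 = 0) x : 0 < x -> 0 < h x.
Proof.
case: h_neq0 => y0; rewrite h_abs; set y := `|y0| => hy x_gt0.
have y_gt0 : 0 < y.
  rewrite lt_def normr_ge0 andbT; apply: contraNneq hy => ->.
  by rewrite h0.
have {}hy : 0 < h y by rewrite lt_def hy h_ge0.
have [xy|/ltW xy] := leP x y.
- have := lt_le_trans (divr_gt0 hy (exprn_gt0 2 y_gt0)) (h_div2_decr _ _ x_gt0 xy).
  by rewrite pmulr_lgt0 // invr_gt0 exprn_gt0.
- have := lt_le_trans (divr_gt0 hy y_gt0) (h_div_incr _ _ y_gt0 xy).
  by rewrite pmulr_lgt0 // invr_gt0.
Qed.

(** Both monotonicity conditions in one multiplicative bound, from which monotonicity, continuity
    and surjectivity of [h] follow. *)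
Lemma hedge_growth (R : realType) (h : R -> R) (t x : R) :
  hedge_function h -> 0 < t -> t <= x ->
  h t * (x / t) <= h x <= h t * (x / t) ^+ 2.
Proof.
move=> [_ _ _ hI hD] t0 tx; have x0 := lt_le_trans t0 tx.
apply/andP; split.
- have := hI _ _ t0 tx; rewrite ler_pdivlMr //; apply: le_trans.
  by rewrite mulrA mulrAC.
- have := hD _ _ t0 tx; rewrite ler_pdivrMr ?exprn_gt0 // => /le_trans; apply.
  by rewrite expr_div_n [leRHS]mulrA mulrAC.
Qed.

Lemma hedge_le (R : realType) (h : R -> R) (x y : R) :
  hedge_function h -> 0 <= x -> x <= y -> h x <= h y.
Proof.
move=> hh; case: (hh) => h0 _ h_gt0 _ _; rewrite le_eqVlt => /predU1P[<-|x0] xy.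
  rewrite h0; move: xy; rewrite le_eqVlt => /predU1P[<-|/h_gt0/ltW//].
  by rewrite h0.
have /andP[+ _] := hedge_growth hh x0 xy; apply: le_trans.
by rewrite ler_peMr ?ler_pdivlMr ?mul1r // ltW // h_gt0.
Qed.

Lemma hedge_continuous (R : realType) (h : R -> R) (x : R) :
  hedge_function h -> 0 < x -> {for x, continuous h}.
Proof.
(* With r = y / x, [hedge_growth] puts [h y] between [h x] r and [h x] r^2 on either side of [x], so
   |h y - h x| is at most [h x * d y]. *)
move=> hh x0; pose d y := `|y / x - 1| + `|(y / x) ^+ 2 - 1|.
have d0 : h x * d y @[y --> x] --> 0.
  have -> : 0 = h x * (`|x / x - 1| + `|(x / x) ^+ 2 - 1|).
    by rewrite divff ?gt_eqF // expr1n subrr normr0 addr0 mulr0.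
  have yx : (y / x) @[y --> x] --> x / x by apply: cvgMl; exact: cvg_id.
  apply: cvgMr; apply: cvgD; apply: cvg_norm; apply: cvgB => //;
    try exact: cvg_cst.
  by under eq_fun do rewrite expr2; rewrite expr2; exact: cvgM.
have bnd : \forall y \near x, h x - h x * d y <= h y <= h x + h x * d y.
  near=> y; have y0 : 0 < y by near: y; exact: lt_nbhsr.
  have hx0 : 0 <= h x by case: hh => _ _ /(_ _ x0)/ltW.
  have [xy|/ltW yx] := leP x y.
    have /andP[lo up] := hedge_growth hh x0 xy.
    have r1 : 1 <= y / x by rewrite ler_pdivlMr // mul1r.
    rewrite /d; set r := y / x in lo up r1 *.
    rewrite (ger0_norm (_ : 0 <= r - 1)) ?subr_ge0 //.
    rewrite ger0_norm ?subr_ge0 ?exprn_ege1 //.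
    have p1 : 0 <= h x * (r - 1) by rewrite mulr_ge0 ?subr_ge0.
    have p2 : 0 <= h x * (r - 1) * r by rewrite mulr_ge0 // (le_trans ler01).
    by apply/andP; split; nra.
  have r1 : y / x <= 1 by rewrite ler_pdivrMr // mul1r.
  have r0 : 0 < y / x by rewrite divr_gt0.
  have /andP[lo up] := hedge_growth hh y0 yx.
  have xyE : x / y = (y / x)^-1 by rewrite invf_div.
  move: lo up; rewrite /d xyE exprVn ler_pdivrMr // ler_pdivlMr ?exprn_gt0 //.
  set r := y / x in r1 r0 *.
  rewrite (ler0_norm (_ : r - 1 <= 0)) ?subr_le0 //.
  rewrite ler0_norm ?subr_le0 ?exprn_ile1 ?(ltW r0) //.
  have p1 : 0 <= h x * (1 - r) by rewrite mulr_ge0 ?subr_ge0.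
  have p2 : 0 <= h x * (1 - r) * r by rewrite mulr_ge0 // ltW.
  by move=> lo up; apply/andP; split; nra.
apply: (squeeze_cvgr bnd).
- by rewrite -[X in _ --> X]subr0; apply: cvgB => //; exact: cvg_cst.
- by rewrite -[X in _ --> X]addr0; apply: cvgD => //; exact: cvg_cst.
Unshelve. all: by end_near. Qed.

Lemma hedge_surj (R : realType) (h : R -> R) :
  hedge_function h -> set_surj `[0, +oo[ `[0, +oo[ h.
Proof.
move=> hh z; case: (hh) => h0 _ h_gt0 _ _.
rewrite /= in_itv /= andbT le_eqVlt => /predU1P[<-|z0].
  by exists 0 => //=; rewrite in_itv /= lexx.
have h1 := h_gt0 1 ltr01; have zh : 0 < z / h 1 by rewrite divr_gt0.
(* Comparison with the line through the origin and (1, [h 1]): [h] lies below it on (0, 1] and above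
   it from 1 on, hence h a <= z <= h b. Both ends are positive, where [h] is known to be
   continuous. *)
pose a := Num.min 1 (z / h 1); pose b := Num.max 1 (z / h 1).
have a0 : 0 < a by rewrite lt_min ltr01.
have a1 : a <= 1 by rewrite ge_min lexx.
have b1 : 1 <= b by rewrite le_max lexx.
have ha : h a <= z.
  have /andP[+ _] := hedge_growth hh a0 a1.
  rewrite div1r ler_pdivrMr // => /le_trans; apply.
  by rewrite mulrC -ler_pdivlMr // ge_min lexx orbT.
have hb : z <= h b.
  have /andP[+ _] := hedge_growth hh ltr01 b1; apply: le_trans.
  by rewrite divr1 mulrC -ler_pdivrMr // le_max lexx orbT.
have ab := le_trans a1 b1.
have : Num.min (h a) (h b) <= z <= Num.max (h a) (h b).
  by rewrite ge_min le_max ha hb orbT.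
case/(IVT ab).
  apply: continuous_in_subspaceT => c; rewrite inE /= in_itv /= => /andP[ac _].
  by apply: hedge_continuous => //; exact: lt_le_trans ac.
move=> c; rewrite in_itv /= => /andP[ac _] <-; exists c => //=.
by rewrite in_itv /= andbT ltW // (lt_le_trans a0).
Qed.

Lemma hedge_invK (R : realType) (h : R -> R) (z : R) :
  hedge_function h -> 0 <= z -> h (hedge_inv h z) = z.
Proof.
move=> hh z0; apply: (surjpK _ (hedge_surj hh)).
by rewrite inE /= in_itv /= z0.
Qed.

Lemma hedge_inv_gt0 (R : realType) (h : R -> R) (z : R) :
  hedge_function h -> 0 < z -> 0 < hedge_inv h z.
Proof.
move=> hh z0; have : 0 <= hedge_inv h z.
  have /(_ (hedge_inv h z)) := surjpinv_image_sub (dflt := fun=> 0) (hedge_surj hh).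
  rewrite /= in_itv /= andbT; apply.
  by exists z => //=; rewrite in_itv /= ltW.
rewrite le_eqVlt => /predU1P[e|//].
have := hedge_invK hh (ltW z0); rewrite -e; case: hh => -> _ _ _ _ z0'.
by move: z0; rewrite -z0' ltxx.
Qed.

Lemma hedge_inv_le (R : realType) (h : R -> R) (z w : R) :
  hedge_function h -> 0 < z -> z <= w -> hedge_inv h z <= hedge_inv h w.
Proof.
move=> hh z0 zw; have w0 := lt_le_trans z0 zw.
rewrite leNgt; apply/negP => lt_wz; have := hedge_inv_gt0 hh w0.
move=> /ltW/(hedge_le hh)/(_ (ltW lt_wz)); rewrite (hedge_invK hh (ltW z0)) (hedge_invK hh (ltW w0)) => wz.
have e : z = w by apply/le_anti; rewrite zw wz.
by move: lt_wz; rewrite e ltxx.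
Qed.

(** * A single round: factors of T and Reality's choice *)

Definition many_factor (R : realType) (q y : R) : R :=
  (if y == 0 then 1 else 2) / (1 + q).

(** One round's share of the term of T that counts N_+ ([s] = 1) or N_- ([s] = -1). *)
Definition few_factor (R : realType) (s q y : R) : R :=
  (if 0 < s * y then 2^-1 else 1) * (1 + q / 4).

Lemma many_factor_gt0 (R : realType) (q y : R) : 0 <= q -> 0 < many_factor q y.
Proof.
by move=> q0; rewrite divr_gt0 ?ltr_wpDr //; case: ifP.
Qed.

Lemma few_factor_gt0 (R : realType) (s q y : R) :
  0 <= q -> 0 < few_factor s q y.
Proof.
move=> q0; rewrite mulr_gt0 ?ltr_wpDr ?divr_ge0 //.
by case: ifP; rewrite ?invr_gt0.
Qed.

(* The law of Reality's move: +a and -a with probability q / 2 each, else 0. *)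
Definition mean3 (R : realType) (q a : R) (F : R -> R) : R :=
  q / 2 * F a + q / 2 * F (- a) + (1 - q) * F 0.

(** Three negative values cannot have a nonnegative average. This is what turns the random draw into
    a deterministic choice. *)
Lemma mean3_ge0 (R : realType) (q a : R) (F : R -> R) :
  0 <= q <= 1 -> 0 <= mean3 q a F ->
  exists y, [/\ y = 0 \/ y = a \/ y = - a & 0 <= F y].
Proof.
move=> /andP[q0 q1]; rewrite /mean3.
have [F0 _|F0] := leP 0 (F 0); first by exists 0; split; [left|].
have [Fa _|Fa] := leP 0 (F a); first by exists a; split; [right; left|].
have [Fb _|Fb] := leP 0 (F (- a)); first by exists (- a); split; [right; right|].
(* For [q] = 1 strict negativity comes from the points [a] and [- a]; otherwise from 0, which has
   weight 1 - q > 0. *)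
have [->|qn1] := eqVneq q 1; first lra.
have {}q1 : q < 1 by rewrite lt_neqAle qn1.
suff : q / 2 * F a + q / 2 * F (- a) + (1 - q) * F 0 < 0 by move/lt_geF ->.
have h1 : q / 2 * F a <= 0 by rewrite mulr_ge0_le0 ?divr_ge0 // ltW.
have h2 : q / 2 * F (- a) <= 0 by rewrite mulr_ge0_le0 ?divr_ge0 // ltW.
have h3 : (1 - q) * F 0 < 0 by rewrite pmulr_rlt0 ?subr_gt0.
lra.
Qed.

Definition test_capital (R : realType) (t1 t2 t3 q y : R) : R :=
  t1 * many_factor q y + t2 * few_factor 1 q y + t3 * few_factor (- 1) q y.

(** [many_factor] has mean (2q + 1 - q) / (1 + q) = 1, and each [few_factor] has mean (1 - q/4)(1 +
    q/4) = 1 - q^2/16. *)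
Lemma mean3_test_capital (R : realType) (t1 t2 t3 q a : R) :
  0 < t1 -> 0 < t2 -> 0 < t3 -> 0 <= q <= 1 -> 0 < a ->
  mean3 q a (test_capital t1 t2 t3 q) <= t1 + t2 + t3.
Proof.
move=> t1_gt0 t2_gt0 t3_gt0 /andP[q0 q1] a_gt0.
rewrite /mean3 /test_capital /many_factor /few_factor.
rewrite oppr_eq0 (gt_eqF a_gt0) eqxx !mul1r !mulN1r !opprK oppr0 ltxx a_gt0.
rewrite oppr_gt0 (lt_gtF a_gt0).
have D : 1 + q != 0 by rewrite gt_eqF // ltr_wpDr.
rewrite [leLHS](_ : _ = t1 + (t2 + t3) * (1 - q ^+ 2 / 16)); last by field.
have : 0 <= (t2 + t3) * (q ^+ 2 / 16).
  by rewrite mulr_ge0 ?divr_ge0 ?sqr_ge0 // addr_ge0 // ltW.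
lra.
Qed.

(* The last condition controls [t] while Skeptic's capital is still exactly 1,
   where the second one is void. *)
Definition acceptable (R : realType) (k k' t t' : R) :=
  [/\ k' <= 1, t' * (1 - k) <= t * (1 - k') & k' = 1 -> t' <= t].

Lemma acceptable_move (R : realType) (h : R -> R) (k M V v a t1 t2 t3 : R) :
  h 0 = 0 -> h (- a) = h a -> 0 < a -> 0 < h a -> 0 <= v <= h a -> 0 <= V ->
  k <= 1 -> 0 < t1 -> 0 < t2 -> 0 < t3 ->
  exists y, (y = 0 \/ y = a \/ y = - a) /\
    acceptable k (k + M * y + V * (h y - v)) (t1 + t2 + t3)
               (test_capital t1 t2 t3 (v / h a) y).
Proof.
move=> h0 hNa a_gt0 ha_gt0 /andP[v0 vh] V0 k1 t1_gt0 t2_gt0 t3_gt0.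
set q := v / h a.
have q01 : 0 <= q <= 1.
  by rewrite divr_ge0 ?(ltW ha_gt0) //= ler_pdivrMr // mul1r.
have vE : v = q * h a by rewrite /q divfK // gt_eqF.
have ET := mean3_test_capital t1_gt0 t2_gt0 t3_gt0 q01 a_gt0.
have [q0 q1] := andP q01.
set T := t1 + t2 + t3 in ET *.
have T_gt0 : 0 < T by rewrite !addr_gt0.
have test_gt0 y : 0 < test_capital t1 t2 t3 q y.
  by rewrite !addr_gt0 // mulr_gt0 ?many_factor_gt0 ?few_factor_gt0.
move: k1; rewrite le_eqVlt => /predU1P[->|k1].
(* Case [k] = 1. If V v > 0, the move 0 costs Skeptic V v. If V = 0 while M and v are nonzero, a
   jump against the sign of M costs him |M| a. If v = 0 and some stake is nonzero, the move 0
   changes neither K nor T. If M = V = 0, then K stays 1 and averaging gives a move that does not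
   increase T. *)
- have [V_eq0|V_neq0] := eqVneq V 0; last first.
    have [v_eq0|v_neq0] := eqVneq v 0.
      exists 0; split; first by left.
      rewrite /q v_eq0 h0 mul0r; split; try lra.
      rewrite /test_capital /many_factor /few_factor eqxx !mulr0 ltxx /T.
      by rewrite !(mul0r, addr0, divr1, mulr1).
    have Vv : 0 < V * v.
      by rewrite mulr_gt0 // lt_def ?V_neq0 ?v_neq0.
    by exists 0; split; [left|rewrite h0; split; nra].
  rewrite V_eq0; have [M_eq0|M_neq0] := eqVneq M 0.
    have : 0 <= mean3 q a (fun y => T - test_capital t1 t2 t3 q y).
      by move: ET; rewrite /mean3; lra.
    move=> /(mean3_ge0 q01)[y [ya Ty]]; exists y; split=> //.
    by rewrite M_eq0; split; lra.
  have [v_eq0|v_neq0] := eqVneq v 0.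
    exists 0; split; first by left.
    rewrite /q v_eq0 h0 mul0r; split; try lra.
    rewrite /test_capital /many_factor /few_factor eqxx !mulr0 ltxx /T.
    by rewrite !(mul0r, addr0, divr1, mulr1).
  move: M_neq0; rewrite neq_lt => /orP[M0|M0].
    exists a; split; first by right; left.
    have : M * a < 0 by rewrite nmulr_rlt0.
    by move=> ?; split; nra.
  exists (- a); split; first by right; right.
  have : 0 < M * a by rewrite mulr_gt0.
  by move=> ?; split; nra.
(* Case [k] < 1. Under the three-point law y has mean 0 and h(y) has mean q h(a) = v, so the new
   capital has mean [k]; only the nonnegative drift of T remains. *)
- have : 0 <= mean3 q a (fun y => T * (1 - (k + M * y + V * (h y - v)))
                                  - test_capital t1 t2 t3 q y * (1 - k)).
    have -> : mean3 q a (fun y => T * (1 - (k + M * y + V * (h y - v)))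
                                  - test_capital t1 t2 t3 q y * (1 - k))
      = (T - mean3 q a (test_capital t1 t2 t3 q)) * (1 - k).
      by rewrite /mean3 h0 hNa vE; field.
    by rewrite mulr_ge0 // subr_ge0 // ltW.
  move=> /(mean3_ge0 q01)[y [ya]]; rewrite subr_ge0 => Ty; exists y; split=> //.
  have K' : k + M * y + V * (h y - v) < 1.
    rewrite -subr_gt0 -(pmulr_rgt0 _ T_gt0); apply: lt_le_trans Ty.
    by rewrite mulr_gt0 // subr_gt0.
  by split=> //; [exact: ltW|move=> K1; move: K'; rewrite K1 ltxx].
Qed.

(** * The tester T along a play, and the strategy *)

Definition dev (R : realType) (p : play R) (n : nat) : R :=
  outcome (p n) - mean (p n).

(** The index [n.+1] includes the price of the current round, which is announced before Reality
    moves. The maximum keeps [jump_prob] at most 1. *)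
Definition threshold (R : realType) (g : R -> R) (p : play R) (n : nat) : R :=
  Num.max (price (p n)) (g (cumul_price (path_of_play p) n.+1)).

Definition jump_size (R : realType) (h g : R -> R) (p : play R) (n : nat) : R :=
  hedge_inv h (threshold g p n).

Definition jump_prob (R : realType) (g : R -> R) (p : play R) (n : nat) : R :=
  price (p n) / threshold g p n.

Definition many_jumps (R : realType) (g : R -> R) (p : play R) (n : nat) : R :=
  \prod_(k < n) many_factor (jump_prob g p k) (dev p k).

Definition few_jumps (R : realType) (s : R) (g : R -> R) (p : play R) (n : nat) : R :=
  \prod_(k < n) few_factor s (jump_prob g p k) (dev p k).

Definition tester (R : realType) (g : R -> R) (p : play R) (n : nat) : R :=
  many_jumps g p n + few_jumps 1 g p n + few_jumps (- 1) g p n.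

Definition good_round (R : realType) (h g : R -> R) (p : play R) (n : nat) :=
  (dev p n = 0 \/ dev p n = jump_size h g p n \/ dev p n = - jump_size h g p n)
  /\ acceptable (capital h p n) (capital h p n.+1)
                (tester g p n) (tester g p n.+1).

(** The finite history, extended by the candidate outcome and padded with default rounds, serves as
    a play; the padding is harmless by [eq_good_round]. The default 0 of [xget] is not reached in a
    legal play with capital at most 1. *)
Definition avoiding_strategy (R : realType) (h g : R -> R) : reality_strategy R :=
  fun s m v M V =>
    xget 0 [set x | good_round h g
      (nth (Round 0 0 0 0 0) (rcons s (Round m v M V x))) (size s)].

(** * Dependence on the history only *)

Lemma eq_cumul_price (R : realType) (p p' : play R) n :
  (forall k, (k < n)%N -> p k = p' k) ->
  cumul_price (path_of_play p) n = cumul_price (path_of_play p') n.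
Proof. by move=> pp'; apply: eq_bigr => k _ /=; rewrite pp'. Qed.

Lemma eq_threshold (R : realType) (g : R -> R) (p p' : play R) n :
  (forall k, (k <= n)%N -> p k = p' k) -> threshold g p n = threshold g p' n.
Proof.
by move=> pp'; rewrite /threshold (eq_cumul_price (p' := p')) ?pp'.
Qed.

Lemma eq_tester (R : realType) (g : R -> R) (p p' : play R) n :
  (forall k, (k < n)%N -> p k = p' k) -> tester g p n = tester g p' n.
Proof.
move=> pp'; have qE (k : 'I_n) : jump_prob g p k = jump_prob g p' k.
  rewrite /jump_prob pp' // (@eq_threshold _ _ p p') // => j jk.
  by apply: pp'; exact: leq_ltn_trans jk _.
by congr (_ + _ + _); apply: eq_bigr => k _; rewrite qE /dev pp'.
Qed.

Lemma eq_capital (R : realType) (h : R -> R) (p p' : play R) n :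
  (forall k, (k < n)%N -> p k = p' k) -> capital h p n = capital h p' n.
Proof.
elim: n => //= n IHn pp'; rewrite IHn ?pp' // => k kn.
by apply: pp'; exact: ltnW.
Qed.

Lemma eq_good_round (R : realType) (h g : R -> R) (p p' : play R) n :
  (forall k, (k <= n)%N -> p k = p' k) -> good_round h g p n ->
  good_round h g p' n.
Proof.
move=> pp'; have pp k : (k < n)%N -> p k = p' k by move=> /ltnW/pp'.
rewrite /good_round /jump_size (eq_threshold g pp') /dev pp' //.
by rewrite (eq_capital h pp) (eq_capital h (n := n.+1) pp')
           (eq_tester g pp) (eq_tester g (n := n.+1) pp').
Qed.

(** * Good rounds exist, and the strategy keeps T bounded *)

Lemma cumul_price_ge0 (R : realType) (p : play R) n :
  legal p -> 0 <= cumul_price (path_of_play p) n.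
Proof. by move=> pl; apply: sumr_ge0 => k _; case: (pl k). Qed.

Definition positive_scale (R : realType) (g : R -> R) :=
  forall x, 0 <= x -> 0 < g x.

Lemma threshold_gt0 (R : realType) (g : R -> R) (p : play R) n :
  positive_scale g -> legal p -> 0 < threshold g p n.
Proof. by move=> g_gt0 pl; rewrite lt_max g_gt0 ?orbT ?cumul_price_ge0. Qed.

Lemma jump_prob_ge0 (R : realType) (g : R -> R) (p : play R) n :
  positive_scale g -> legal p -> 0 <= jump_prob g p n.
Proof.
move=> g_gt0 pl; rewrite divr_ge0 ?(ltW (threshold_gt0 _ _ _)) //.
by case: (pl n).
Qed.

Lemma many_jumps_gt0 (R : realType) (g : R -> R) (p : play R) n :
  positive_scale g -> legal p -> 0 < many_jumps g p n.
Proof.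
by move=> *; apply: prodr_gt0 => k _; rewrite many_factor_gt0 ?jump_prob_ge0.
Qed.

Lemma few_jumps_gt0 (R : realType) (s : R) (g : R -> R) (p : play R) n :
  positive_scale g -> legal p -> 0 < few_jumps s g p n.
Proof.
by move=> *; apply: prodr_gt0 => k _; rewrite few_factor_gt0 ?jump_prob_ge0.
Qed.

Lemma tester_gt0 (R : realType) (g : R -> R) (p : play R) n :
  positive_scale g -> legal p -> 0 < tester g p n.
Proof. by move=> *; rewrite !addr_gt0 ?many_jumps_gt0 ?few_jumps_gt0. Qed.

Lemma good_round_exists (R : realType) (h g : R -> R) (p : play R) n :
  hedge_function h -> positive_scale g -> legal p -> capital h p n <= 1 ->
  exists x, good_round h g (fun k => if k == n then
     Round (mean (p n)) (price (p n)) (stake_mean (p n)) (stake_hedge (p n)) x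
     else p k) n.
Proof.
move=> hh g_gt0 pl k1; case: (hh) => h0 h_abs h_gt0 _ _.
have th_gt0 := threshold_gt0 n g_gt0 pl.
pose a := jump_size h g p n.
have a_gt0 : 0 < a by exact: (hedge_inv_gt0 hh th_gt0).
have ha : h a = threshold g p n by exact: hedge_invK hh (ltW th_gt0).
have [v0 V0] := pl n.
have vh : 0 <= price (p n) <= h a by rewrite v0 ha le_max lexx.
have hNa : h (- a) = h a by rewrite h_abs normrN -h_abs.
have ha_gt0 : 0 < h a by rewrite ha.
have [y [ya acc]] := acceptable_move (stake_mean (p n)) h0 hNa a_gt0 ha_gt0 vh V0 k1
  (many_jumps_gt0 n g_gt0 pl) (few_jumps_gt0 1 n g_gt0 pl)
  (few_jumps_gt0 (- 1) n g_gt0 pl).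
exists (mean (p n) + y); set p' := fun _ => _.
have p'p k : (k < n)%N -> p' k = p k by move=> kn; rewrite /p' ltn_eqF.
(* Only the outcome of round [n] is altered, so all prices, and with them all thresholds and jump
   probabilities, stay the same. *)
have vp k : price (p' k) = price (p k) by rewrite /p'; case: eqP => [->|].
have thE : threshold g p' n = threshold g p n.
  rewrite /threshold vp; congr (Num.max _ (g _)).
  by apply: eq_bigr => k _ /=; rewrite vp.
have devE : dev p' n = y by rewrite /dev /p' eqxx /= addrC addKr.
have qE : jump_prob g p' n = price (p n) / h a by rewrite /jump_prob thE vp ha.
have capE : capital h p' n = capital h p n by exact: eq_capital.
have capSE : capital h p' n.+1 =
    capital h p n + stake_mean (p n) * y + stake_hedge (p n) * (h y - price (p n)).
  by rewrite /= capE -/(dev p' n) devE /p' eqxx.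
have tE : tester g p' n = tester g p n by exact: eq_tester.
have qpE k : jump_prob g p' k = jump_prob g p k.
  rewrite /jump_prob /threshold vp; congr (_ / Num.max _ (g _)).
  by apply: eq_bigr => j _ /=; rewrite vp.
have manyE : many_jumps g p' n = many_jumps g p n.
  by apply: eq_bigr => k _; rewrite qpE /dev p'p.
have fewE s : few_jumps s g p' n = few_jumps s g p n.
  by apply: eq_bigr => k _; rewrite qpE /dev p'p.
have tSE : tester g p' n.+1 = test_capital (many_jumps g p n) (few_jumps 1 g p n)
    (few_jumps (- 1) g p n) (price (p n) / h a) y.
  rewrite /tester /test_capital -qE -manyE -!fewE.
  by rewrite /many_jumps /few_jumps !big_ord_recr /= devE.
by split; rewrite ?devE /jump_size ?thE // capE capSE tE tSE.
Qed.

Lemma follows_good_round (R : realType) (h g : R -> R) (p : play R) n :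
  hedge_function h -> positive_scale g -> legal p ->
  follows (avoiding_strategy h g) p -> capital h p n <= 1 -> good_round h g p n.
Proof.
move=> hh g_gt0 pl pf k1.
pose past x := nth (Round 0 0 0 0 0) (rcons (mkseq p n)
  (Round (mean (p n)) (price (p n)) (stake_mean (p n)) (stake_hedge (p n)) x)).
have pastE x k : (k <= n)%N -> past x k = if k == n then
     Round (mean (p n)) (price (p n)) (stake_mean (p n)) (stake_hedge (p n)) x
     else p k.
  rewrite /past nth_rcons size_mkseq leq_eqVlt => /predU1P[->|kn].
    by rewrite ltnn eqxx.
  by rewrite kn nth_mkseq // ltn_eqF.
have : good_round h g (past (outcome (p n))) n.
  rewrite pf /avoiding_strategy size_mkseq; apply: (@xgetPex _ 0 [set x | good_round h g (past x) n]).
  have [x gx] := good_round_exists hh g_gt0 pl k1; exists x => /=.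
  by apply: eq_good_round gx => k kn; rewrite pastE.
apply: eq_good_round => k kn; rewrite pastE //.
by case: eqP => // ->; case: (p n).
Qed.

Lemma follows_capital_le1 (R : realType) (h g : R -> R) (p : play R) n :
  hedge_function h -> positive_scale g -> legal p ->
  follows (avoiding_strategy h g) p -> capital h p n <= 1.
Proof.
move=> hh g_gt0 pl pf; elim: n => // n IHn.
by case: (follows_good_round hh g_gt0 pl pf IHn) => _ [].
Qed.

(* The ratio [(1 - K_n) / T_n] never decreases, and [0 <= K_n]: once it is
   positive it bounds [T_n]; as long as it is zero, [T_n] does not increase. *)
Lemma tester_bounded (R : realType) (h g : R -> R) (p : play R) :
  positive_scale g -> legal p -> collateral_duty h p ->
  (forall n, good_round h g p n) -> exists C, forall n, tester g p n <= C.
Proof.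
move=> g_gt0 pl cd gr; have T_gt0 n := tester_gt0 n g_gt0 pl.
have step n : tester g p n.+1 * (1 - capital h p n) <=
              tester g p n * (1 - capital h p n.+1) by case: (gr n) => _ [].
have cap1 n : capital h p n <= 1 by case: n => // n; case: (gr n) => _ [].
have [[N KN]|] := pselect (exists N, capital h p N < 1); last first.
  move=> /forallNP K1; exists (tester g p 0%N); elim=> // n; apply: le_trans.
  case: (gr n) => _ [_ _]; apply; apply/le_anti; rewrite cap1.
  by rewrite leNgt; apply/negP; exact: K1.
have c_gt0 : 0 < 1 - capital h p N by rewrite subr_gt0.
have ratio n : (1 - capital h p N) / tester g p N
            <= (1 - capital h p (N + n)) / tester g p (N + n).
  elim: n => [|n]; rewrite ?addn0 ?addnS // => /le_trans; apply.
  rewrite ler_pdivrMr // mulrAC ler_pdivlMr // mulrC [leRHS]mulrC.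
  exact: step.
have bnd n : tester g p (N + n) <= tester g p N / (1 - capital h p N).
  rewrite ler_pdivlMr //; have := ratio n.
  rewrite ler_pdivrMr // mulrAC ler_pdivlMr // mulrC => /le_trans; apply.
  by rewrite ler_piMl ?(ltW (T_gt0 _)) // gerBl; exact: cd.
(* The finite sum takes care of the rounds before [N]. *)
exists (tester g p N / (1 - capital h p N) + \sum_(k < N) tester g p k) => n.
have [nN|Nn] := ltnP n N.
  rewrite (bigD1 (Ordinal nN)) //= addrCA lerDl addr_ge0 // ?divr_ge0 ?(ltW c_gt0) ?(ltW (T_gt0 _)) //.
  by apply: sumr_ge0 => k _; rewrite ltW.
rewrite -(subnKC Nn) (le_trans (bnd _)) // lerDl.
by apply: sumr_ge0 => k _; rewrite ltW.
Qed.

(** * From bounded T to the event *)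

Lemma prod_ge_sum (R : realType) (u : R^nat) n :
  (forall k, 0 <= u k) -> 1 + \sum_(k < n) u k <= \prod_(k < n) (1 + u k).
Proof.
move=> u0; elim: n => [|n IHn]; first by rewrite !big_ord0 addr0.
rewrite !big_ord_recr /=; have := u0 n.
have : 0 <= \sum_(k < n) u k by exact: sumr_ge0.
by set S := \sum_(k < n) _ in IHn *; set P := \prod_(k < n) _ in IHn *; nra.
Qed.

(** Applied to indicators of jumps, where a value below 1 means no jump, and to jump probabilities,
    where it means that the price is below the scale [g]. *)
Lemma bounded_sum_near_lt1 (R : realType) (u : R^nat) C :
  (forall k, 0 <= u k) -> (forall n, \sum_(k < n) u k <= C) ->
  \forall n \near \oo, u n < 1.
Proof.
move=> u0 uC; have su : cvgn (series u).
  apply: nondecreasing_is_cvgn; last first.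
    by exists C => _ [n _ <-]; rewrite /series /= big_mkord.
  by apply/nondecreasing_seqP => n; rewrite /series /= big_nat_recr //= lerDl.
by apply: (cvgr_lt _ (cvg_series_cvg_0 su)).
Qed.

Lemma nneseries_ltyP (R : realType) (u : R^nat) : (forall k, 0 <= u k) ->
  (\sum_(0 <= n <oo) (u n)%:E < +oo)%E <->
  exists C, forall n, \sum_(k < n) u k <= C.
Proof.
move=> u0; have u0' n : (0 <= n)%N -> true -> (0 <= (u n)%:E)%E.
  by rewrite lee_fin.
split=> [uoo|[C uC]].
  exists (fine (\sum_(0 <= n <oo) (u n)%:E)%E) => n.
  rewrite -lee_fin fineK; last first.
    by rewrite ge0_fin_numE //; apply: nneseries_ge0 => k *; rewrite lee_fin.
  by apply: le_trans (nneseries_lim_ge n u0'); rewrite big_mkord sumEFin.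
apply: (@le_lt_trans _ _ C%:E); last exact: ltry.
apply: lime_le; first exact: is_cvg_nneseries.
by near=> n; rewrite sumEFin lee_fin big_mkord.
Unshelve. all: by end_near. Qed.

Lemma bounded_sum_near_le (R : realType) (u w : R^nat) C :
  (forall k, 0 <= u k) -> (forall k, 0 <= w k) ->
  (\forall n \near \oo, u n <= w n) ->
  (forall n, \sum_(k < n) w k <= C) -> exists D, forall n, \sum_(k < n) u k <= D.
Proof.
move=> u0 w0 [N _ uw] wC; exists (\sum_(k < N) u k + C) => n.
have [nN|Nn] := leqP n N.
  apply: ler_wpDr; first by have := wC 0%N; rewrite big_ord0.
  rewrite -!(big_mkord xpredT u) [leRHS](big_cat_nat (n := n)) //=.
  by rewrite lerDl sumr_ge0.
rewrite -!(big_mkord xpredT u) (big_cat_nat (n := N)) ?(ltnW Nn) //= lerD2l.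
apply: le_trans (wC n).
rewrite -(big_mkord xpredT w) [leRHS](big_cat_nat (n := N)) ?(ltnW Nn) //=.
rewrite ler_wpDl ?sumr_ge0 // big_nat_cond [leRHS]big_nat_cond.
by apply: ler_sum => k /andP[/andP[Nk _] _]; exact: uw.
Qed.

(** Once jumps of sign [s] have stopped, every round multiplies the product by 1 + q/4, so it grows
    at least linearly in the sum of the q. *)
Lemma few_jumps_bounded (R : realType) (s C : R) (g : R -> R) (p : play R) :
  positive_scale g -> legal p -> (forall n, few_jumps s g p n <= C) ->
  (\forall n \near \oo, ~~ (0 < s * dev p n)) ->
  exists D, forall n, \sum_(k < n) jump_prob g p k <= D.
Proof.
move=> g_gt0 pl fC [N _ nojump]; have q0 k := jump_prob_ge0 k g_gt0 pl.
pose Q n := \sum_(k < n) jump_prob g p k.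
have Qle n m : Q n <= Q (n + m)%N.
  elim: m => [|m IHm]; first by rewrite addn0.
  by rewrite addnS (le_trans IHm) // /Q big_ord_recr /= lerDl.
have fN := few_jumps_gt0 s N g_gt0 pl.
have growth n : few_jumps s g p N * (1 + (Q (N + n)%N - Q N) / 4)
             <= few_jumps s g p (N + n).
  elim: n => [|n IHn]; first by rewrite addn0 subrr mul0r addr0 mulr1.
  have -> : few_jumps s g p (N + n.+1) =
      few_jumps s g p (N + n) * (1 + jump_prob g p (N + n) / 4).
    rewrite addnS {1}/few_jumps big_ord_recr /= {2}/few_factor.
    by rewrite (negbTE (nojump (N + n)%N _)) ?mul1r //= leq_addr.
  have -> : Q (N + n.+1)%N = Q (N + n)%N + jump_prob g p (N + n).
    by rewrite addnS /Q big_ord_recr.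
  have X0 : 0 <= 1 + jump_prob g p (N + n) / 4 by rewrite addr_ge0 // divr_ge0 // q0.
  apply: le_trans _ (ler_wpM2r X0 IHn).
  rewrite -mulrA ler_pM2l //; have := Qle N n; have := q0 (N + n)%N.
  by nra.
(* Obtained by solving f (1 + (Q - Q_N) / 4) <= C for Q, with f the product at [N]. *)
exists (Q N + 4 * C / few_jumps s g p N) => n; rewrite -/(Q n).
apply: (le_trans (Qle n N)); rewrite addnC -lerBlDl ler_pdivlMr //.
have := le_trans (growth n) (fC _).
nra.
Qed.

(** The number N of jumps satisfies 2^N = [many_jumps] * prod (1 + q_k) <= C exp(D), hence stays
    bounded. *)
Lemma many_jumps_bounded (R : realType) (C D : R) (g : R -> R) (p : play R) :
  positive_scale g -> legal p -> (forall n, many_jumps g p n <= C) ->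
  (forall n, \sum_(k < n) jump_prob g p k <= D) ->
  \forall n \near \oo, dev p n = 0.
Proof.
move=> g_gt0 pl mC qD; have q0 k := jump_prob_ge0 k g_gt0 pl.
pose j k : R := (dev p k != 0)%:R.
have : \forall n \near \oo, j n < 1.
  apply: (@bounded_sum_near_lt1 _ j (C * expR D)) => [k|n]; first exact: ler0n.
  have : 1 + \sum_(k < n) j k <= \prod_(k < n) (1 + j k).
    by apply: prod_ge_sum => k; exact: ler0n.
  suff : \prod_(k < n) (1 + j k) <= C * expR D by lra.
  have -> : \prod_(k < n) (1 + j k)
          = many_jumps g p n * \prod_(k < n) (1 + jump_prob g p k).
    rewrite -big_split; apply: eq_bigr => k _ /=.
    rewrite /many_factor divfK /j; last by rewrite gt_eqF // ltr_wpDr // q0.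
    by case: (dev p k == 0); rewrite /= ?addr0 // -[2]natr1.
  apply: ler_pM => //; first exact/ltW/many_jumps_gt0.
    by apply: prodr_ge0 => k _; rewrite addr_ge0 // q0.
  apply: (@le_trans _ _ (expR (\sum_(k < n) jump_prob g p k))).
    rewrite expR_sum; apply: ler_prod => k _.
    by rewrite addr_ge0 ?q0 //= expR_ge1Dx.
  by rewrite ler_expR.
by apply: filterS => n; rewrite /j; case: eqP => //=; rewrite ltxx.
Qed.

(* As the scale [b] increases, a limit [l] of [S / b] leaves no room for jumps
   of size at least [b] in the direction opposite to [l]. *)
Lemma cvg_ratio_no_jump (R : realType) (S b : R^nat) (l : R) :
  (forall n, 0 < b n) -> (forall n, b n <= b n.+1) -> l <= 0 ->
  S n / b n @[n --> \oo] --> l ->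
  \forall n \near \oo, S n.+1 - S n < b n.+1.
Proof.
move=> b0 b_le l0 Sl.
(* With tolerance 1/4 the increment is below l (b_{n+1} - b_n) + (b_{n+1} + b_n) / 4, which is at
   most b_{n+1} / 2 since l <= 0 and [b] increases. *)
have [N _ near_l] : \forall n \near \oo, l - 4^-1 < S n / b n < l + 4^-1.
  near=> n; apply/andP; split; near: n.
    by apply: (cvgr_gt _ Sl); rewrite gtrBl invr_gt0.
  by apply: (cvgr_lt _ Sl); rewrite ltrDl invr_gt0.
exists N => // n /= Nn.
have /andP[lo _] := near_l n Nn; have /andP[_ up] := near_l n.+1 (leqW Nn).
move: lo up; rewrite ltr_pdivlMr // ltr_pdivrMr //.
by have := b0 n; have := b_le n; nra.
Unshelve. all: by end_near. Qed.

Lemma cvg_ratio_near_cst (R : realType) (S b : R^nat) :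
  (forall n, 0 < b n) -> (forall n, b n <= b n.+1) ->
  (\forall n \near \oo, S n.+1 = S n) -> cvgn (fun n => S n / b n).
Proof.
move=> b0 b_le [N _ SN].
have cb : cvgn (fun n => (b n)^-1).
  apply: nonincreasing_is_cvgn; last first.
    by exists 0 => _ [n _ <-]; rewrite invr_ge0 ltW.
  by apply/nonincreasing_seqP => n; rewrite lef_pV2 ?posrE.
have cSb : cvgn (fun n => S N / b n) by apply: is_cvgMr; exact: cb.
apply: cvgP; apply: cvg_trans cSb; apply: near_eq_cvg.
exists N => // n /= Nn; congr (_ / _).
rewrite -(subnKC Nn); elim: (n - N)%N => [|k ->]; first by rewrite addn0.
by rewrite addnS SN //= leq_addr.
Qed.

(** If the series converges, so does the sum of the q; jumps then stop and the numerator freezes.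
    Conversely, a limit rules out late jumps of one sign, which bounds the sum of the q and thus the
    series. *)
Lemma tester_bounded_cvg_iff (R : realType) (h g : R -> R) (p : play R) (C : R)
  (xi := path_of_play p) :
  hedge_function h -> positive_scale g ->
  (forall x y, 0 <= x -> x <= y -> g x <= g y) ->
  legal p ->
  (forall n, dev p n = 0 \/ dev p n = jump_size h g p n
             \/ dev p n = - jump_size h g p n) ->
  (forall n, tester g p n <= C) ->
  (\sum_(0 <= n <oo) (path_v xi n / g (cumul_price xi n.+1))%:E < +oo)%E <->
  cvgn (fun n => cumul_dev xi n.+1 / hedge_inv h (g (cumul_price xi n.+1))).
Proof.
move=> hh g_gt0 g_incr pl jumps tC.
pose b n := hedge_inv h (g (cumul_price xi n.+1)).
pose S n := cumul_dev xi n.+1.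
pose u n := price (p n) / g (cumul_price xi n.+1).
have A0 n : 0 <= cumul_price xi n by exact: cumul_price_ge0.
have gA0 n : 0 < g (cumul_price xi n) by exact: g_gt0.
have b0 n : 0 < b n by exact: (hedge_inv_gt0 hh (gA0 _)).
have b_le n : b n <= b n.+1.
  apply: (hedge_inv_le hh (gA0 _)); apply: g_incr => //.
  by rewrite /cumul_price [leRHS]big_ord_recr /= lerDl; case: (pl n.+1).
have SE n : S n.+1 - S n = dev p n.+1.
  have -> : S n.+1 = S n + dev p n.+1 by rewrite /S /cumul_dev big_ord_recr.
  by rewrite addrC addKr.
have jump_ge n : b n <= jump_size h g p n.
  by apply: (hedge_inv_le hh (gA0 _)); rewrite le_max lexx orbT.
have q0 k := jump_prob_ge0 k g_gt0 pl.
have u0 n : 0 <= u n by rewrite divr_ge0 ?(ltW (gA0 _)) //; case: (pl n).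
have t0 := many_jumps_gt0 _ g_gt0 pl; have f0 s n := few_jumps_gt0 s n g_gt0 pl.
have mC n : many_jumps g p n <= C.
  by apply: le_trans (tC n); rewrite /tester -addrA lerDl addr_ge0 // ltW.
have fC s n : s = 1 \/ s = - 1 -> few_jumps s g p n <= C.
  move=> s1; apply: le_trans (tC n); rewrite /tester.
  have := t0 n; have := f0 1 n; have := f0 (- 1) n.
  by case: s1 => ->; lra.
rewrite (nneseries_ltyP u0); split=> [[D uD]|/cvg_ex[l Sl]].
  apply: (cvg_ratio_near_cst b0 b_le).
  have qD n : \sum_(k < n) jump_prob g p k <= D.
    apply: le_trans (uD n); apply: ler_sum => k _; apply: ler_wpM2l.
      by case: (pl k).
    by rewrite lef_pV2 ?posrE ?threshold_gt0 // le_max lexx orbT.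
  have [N _ dev0] := many_jumps_bounded g_gt0 pl mC qD.
  exists N => // n /= Nn; apply/eqP; rewrite -subr_eq0 SE.
  by apply/eqP/dev0; exact: leqW.
(* The sign [s] opposes the limit, so that [cvg_ratio_no_jump] applies to [s * S n]. *)
have [s [s1 sl]] : exists s : R, (s = 1 \/ s = - 1) /\ s * l <= 0.
  have [l0|/ltW l0] := leP l 0; first by exists 1; rewrite mul1r; split; [left|].
  by exists (- 1); rewrite mulN1r oppr_le0; split; [right|].
have [D qD] : exists D, forall n, \sum_(k < n) jump_prob g p k <= D.
  apply: (few_jumps_bounded g_gt0 pl (fun n => fC s n s1)).
  have sSl : s * S n / b n @[n --> \oo] --> s * l.
    under eq_fun do rewrite -mulrA.
    by apply: cvgMr; exact: Sl.
  have [N _ small] := cvg_ratio_no_jump b0 b_le sl sSl.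
  (* The increment from [S n] to [S n.+1] is the deviation of round [n.+1], hence the shift by
     one. *)
  exists N.+1 => // -[//|n] /= Nn; apply/negP => sdev.
  have := small n Nn; rewrite -mulrBr SE; have := jump_ge n.+1; have := b0 n.+1.
  by move: sdev; case: s1 => ->; case: (jumps n.+1) => [->|[->|->]]; lra.
(* Where q_n < 1 the maximum in [threshold] is g(A_n), so q_n coincides with the term [u n] of the
   series. *)
have q_lt1 := bounded_sum_near_lt1 q0 qD.
apply: (bounded_sum_near_le u0 q0 _ qD).
apply: filterS q_lt1 => n; rewrite /jump_prob ltr_pdivrMr ?threshold_gt0 // mul1r.
rewrite /threshold lt_max ltxx /= => /ltW vg.
by rewrite /u /xi (max_idPr vg).
Qed.

Theorem theorem4p4 (R : realType) (h g : R -> R)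
  (h_neq0 : exists x, h x != 0)
  (h_abs : forall x, h x = h `|x|)
  (h_ge0 : forall x, 0 <= h x)
  (h_div_incr : forall x y, 0 < x -> x <= y -> h x / x <= h y / y)
  (h_div2_decr : forall x y, 0 < x -> x <= y -> h y / y ^+ 2 <= h x / x ^+ 2)
  (h0 : h 0 = 0)
  (g_gt0 : forall x, 0 <= x -> 0 < g x)
  (g_incr : forall x y, 0 <= x -> x <= y -> g x <= g y) :
  can_strongly_comply h
    [set xi : game_path R |
      (\sum_(0 <= n <oo)
         (path_v xi n / g (cumul_price xi n.+1))%:E < +oo)%E
      <-> cvgn (fun n : nat =>
            cumul_dev xi n.+1 / hedge_inv h (g (cumul_price xi n.+1)))].
Proof.
have hh : hedge_function h.
  by split=> // x; exact: (hedge_gt0 h_neq0 h_abs h_ge0).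
exists (avoiding_strategy h g) => p pl cd pf.
have cap1 n := follows_capital_le1 n hh g_gt0 pl pf.
have gr n := follows_good_round hh g_gt0 pl pf (cap1 n).
have [C tC] := tester_bounded g_gt0 pl cd gr.
split; last exact: cap1.
by apply: tester_bounded_cvg_iff tC => // n; case: (gr n).
Qed.
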